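(* Let $n=2m+1$ with $m\ge1$, let $a,b,c,d\in\mathbb{C}$, and suppose $T_n$ (degree $n$) and $U_{n-2}$ (degree at most $n-2$) satisfy $T_n^2-HU_{n-2}^2=1$ with $$T_n(z)=1-\frac{2(z-d)\prod_{j=1}^{m}(z-x_j)^2}{(a-d)\prod_{j=1}^m(a-x_j)^2}=-1+\frac{2(z-a)(z-b)(z-c)\prod_{j=1}^{m-1}(z-y_j)^2}{(d-a)(d-b)(d-c)\prod_{j=1}^{m-1}(d-y_j)^2}$$ for some $x_1,\dots,x_m,y_1,\dots,y_{m-1}\in\mathbb{C}$. Put $s_k:=\tfrac12\bigl(a^k+b^k+c^k+d^k\bigr)$, $k=1,\dots,2m$, and form $F_k,\mathbf F,\mathbf F_i$ with $\nu=m+1$, $\mu=m-1$. Then $\det\mathbf F\neq0$ and $y_1,\dots,y_{m-1}$ (with multiplicity) are exactly the zeros of the polynomial $$y^{m-1}\det\mathbf F+y^{m-2}\det\mathbf F_1+\dots+y\det\mathbf F_{m-2}+\det\mathbf F_{m-1}.$$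
   Context: $H(z)=(z-a)(z-b)(z-c)(z-d)$. Given complex numbers $s_1,s_2,\dots$, set $F_0:=1$, $F_k:=0$ for $k<0$, and for $k\ge1$, $F_k:=\frac{(-1)^k}{k!}\det M_k$ where $M_k$ is the $k\times k$ matrix with entry $s_{i-j+1}$ for $j\le i$, entry $i$ at position $(i,i+1)$, and $0$ elsewhere. For integers $\nu\ge0,\mu\ge0$, $\mathbf F$ is the $\mu\times\mu$ matrix with $(i,j)$ entry $F_{\nu+i-j}$, and $\mathbf F_i$ ($1\le i\le\mu$) is $\mathbf F$ with its $i$-th column replaced by $(-F_{\nu+1},\dots,-F_{\nu+\mu})^T$. Convention: if $\mu=0$, $\det\mathbf F:=1$ (so for $m=1$ the polynomial is the nonzero constant $1$ and there are no $y_j$). The $x_j,y_j$ are the zeros of $U_{n-2}$, i.e. the extremal points of $T_n$ on $T_n^{-1}([-1,1])$. *)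

(* Defs.v *)
From HB Require Import structures.
From mathcomp Require Import all_boot all_order all_algebra.
Set Implicit Arguments. Unset Strict Implicit. Unset Printing Implicit Defensive.
Import Order.TTheory GRing.Theory Num.Theory.
Local Open Scope ring_scope.

Section Defs.
Variable C : numClosedFieldType.

Definition Hpoly (a b c d : C) : {poly C} :=
  ('X - a%:P) * ('X - b%:P) * ('X - c%:P) * ('X - d%:P).

Definition spow (a b c d : C) (k : nat) : C :=
  (a ^+ k + b ^+ k + c ^+ k + d ^+ k) / 2%:R.

(* M_k : k x k matrix, (1-indexed) entry s_{i-j+1} for j <= i,
   entry i at (i,i+1), 0 elsewhere.  Here i,j are 0-indexed. *)
Definition Mk (s : nat -> C) (k : nat) : 'M[C]_k :=
  \matrix_(i < k, j < k)
    if (j <= i)%N then s (i - j + 1)%N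
    else if j == i.+1 :> nat then (i.+1)%:R else 0.

Definition Fnat (s : nat -> C) (k : nat) : C :=
  (-1) ^+ k / (k`!)%:R * \det (Mk s k).

Definition Fint (s : nat -> C) (k : int) : C :=
  match k with
  | Posz n => Fnat s n
  | Negz _ => 0
  end.

Definition FF (s : nat -> C) (nu mu : nat) : 'M[C]_mu :=
  \matrix_(i < mu, j < mu) Fint s (nu%:Z + i%:Z - j%:Z).

(* bold F_i (0-indexed column i, i.e. paper's F_{i+1}): column i replaced by
   (-F_{nu+1}, ..., -F_{nu+mu})^T *)
Definition FFi (s : nat -> C) (nu mu : nat) (i : 'I_mu) : 'M[C]_mu :=
  \matrix_(r < mu, c < mu)
    if c == i then - Fint s (nu + r + 1)%N%:Z else FF s nu mu r c.

Definition Fpoly (s : nat -> C) (nu mu : nat) : {poly C} :=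
  (\det (FF s nu mu)) *: 'X^mu
  + \sum_(i < mu) (\det (FFi s nu i)) *: 'X^(mu - 1 - i).
End Defs.

(* Main.v *)
Require Import Defs.
From HB Require Import structures.
From mathcomp Require Import all_boot all_order all_algebra.
From mathcomp Require Import ring zify.
Set Implicit Arguments. Unset Strict Implicit. Unset Printing Implicit Defensive.
Import Order.TTheory GRing.Theory Num.Theory.
Local Open Scope ring_scope.

(* The two expressions of T have the same leading coefficient, so with
   P = prod (z - x_j) and Q = prod (z - y_j) they give
   (z-a)(z-b)(z-c) Q^2 - (z-d) P^2 = const <> 0.  In t = 1/z this becomes
     A p^2 - (1-dt) q1^2 = e t^(2m+1),   A = (1-at)(1-bt)(1-ct).
   By Newton's recursion G = sum F_k t^k satisfies G^2 = A (1-dt): both sides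
   have the same logarithmic derivative.  Hence
   (Gp - (1-dt)q1)(Gp + (1-dt)q1) = O(t^(2m+1)), and since the second factor
   is 2 at t = 0, Gp - (1-dt)q1 = O(t^(2m+1)).  Reading off the coefficients
   m+2, ..., 2m, the coefficients of p solve the linear system with matrix F,
   whose determinant is nonzero because the Pade approximant is unique;
   Cramer's rule concludes. *)

(** * Polynomials modulo a power of ['X], and determinants with a replaced column *)

Lemma dvdXnP (R : fieldType) (N : nat) (p : {poly R}) :
  reflect (forall i, (i < N)%N -> p`_i = 0) ('X^N %| p)%R.
Proof.
apply: (iffP idP) => [/dvdpP[q ->] i ltiN|p0]; first by rewrite coefMXn ltiN.
rewrite -(poly_take_drop N p); apply/dvdpP; exists (drop_poly N p).
suff -> : take_poly N p = 0 by rewrite add0r.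
by apply/polyP=> i; rewrite coef_take_poly coef0; case: ifP => // /p0.
Qed.

Lemma size_polyM_le (R : nzRingType) (p q : {poly R}) (i j : nat) :
  (size p <= i)%N -> (size q <= j)%N -> (size (p * q)%R <= (i + j).-1)%N.
Proof.
move=> szp szq; apply: leq_trans (size_polyMleq _ _) _.
by rewrite -!subn1 leq_sub2r // leq_add.
Qed.

Lemma size_polyB_le (R : nzRingType) (p q : {poly R}) (i : nat) :
  (size p <= i)%N -> (size q <= i)%N -> (size (p - q)%R <= i)%N.
Proof.
move=> szp szq; apply: leq_trans (size_polyD _ _) _.
by rewrite size_polyN geq_max szp.
Qed.

Lemma size_1subZX (R : nzRingType) (a : R) : (size (1 - a *: 'X)%R <= 2)%N.
Proof.
apply: size_polyB_le; first by rewrite size_poly1.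
by apply: leq_trans (size_scale_leq _ _) _; rewrite size_polyX.
Qed.

Lemma coprimepXn (R : fieldType) (N : nat) (p : {poly R}) :
  p`_0 != 0 -> coprimep ('X^N) p.
Proof.
move=> p0; apply: coprimep_expl; rewrite coprimep_sym.
have -> : 'X = 'X - 0%:P :> {poly R} by rewrite polyC0 subr0.
by rewrite coprimep_XsubC rootE horner_coef0.
Qed.

(** The points 1, 2, 3, ... are distinct and nonzero in characteristic 0, and the difference has too
    many of them as roots. This allows evaluation at t = 1/z. *)
Lemma eq_poly_nonzero (R : numFieldType) (p q : {poly R}) :
  (forall t, t != 0 -> p.[t] = q.[t]) -> p = q.
Proof.
move=> pq; apply/eqP; rewrite -subr_eq0; apply/eqP.
apply: (@roots_geq_poly_eq0 _ _ [seq i.+1%:R | i <- iota 0 (size (p - q))]).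
- apply/allP=> _ /mapP[i _ ->]; rewrite rootE hornerD hornerN pq ?subrr //.
  by rewrite pnatr_eq0.
- rewrite map_inj_uniq ?iota_uniq // => i j /eqP; rewrite eqr_nat.
  by move=> /eqP[].
- by rewrite size_map size_iota.
Qed.

(** Cramer's rule in a division-free form: [A] and [B] have the same cofactors along column [i], so
    expanding there gives entry [i] of [\adj A *m (A *m v)]. *)
Lemma det_col_replaced (R : comNzRingType) (n : nat) (A B : 'M[R]_n)
    (v : 'cV[R]_n) (i : 'I_n) :
  (forall r c, B r c = if c == i then (A *m v) r 0 else A r c) ->
  \det B = \det A * v i 0.
Proof.
move=> BE; rewrite (expand_det_col B i).
have -> : \det A * v i 0 = (\adj A *m (A *m v)) i 0.
  by rewrite mulmxA mul_adj_mx mul_scalar_mx mxE.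
rewrite mxE; apply: eq_bigr => r _; rewrite BE eqxx mulrC; congr (_ * _).
rewrite mxE /cofactor; congr (_ * \det _); apply/matrixP => k l.
by rewrite !mxE BE eq_sym (negPf (neq_lift _ _)).
Qed.

(** * Newton's recursion for the determinants F_k *)

Section Newton.
Variables (C : numClosedFieldType) (s : nat -> C).

Definition newton_rec (f : nat -> C) (k : nat) :=
  k.+1%:R * f k.+1 = - \sum_(j < k.+1) s (k.+1 - j)%N * f j.

Lemma newton_rec_exists n :
  exists f, f 0%N = 1 /\ forall k, (k < n)%N -> newton_rec f k.
Proof.
elim: n => [|n [f [f0 fP]]]; first by exists (fun=> 1).
pose g k := if k == n.+1 then
  - (\sum_(j < n.+1) s (n.+1 - j)%N * f j) / n.+1%:R else f k.
have gf k : (k <= n)%N -> g k = f k by move=> lekn; rewrite /g ltn_eqF.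
exists g; split=> [|k]; first by rewrite gf.
rewrite ltnS => lekn; rewrite /newton_rec.
under eq_bigr => j _ do rewrite gf ?(leq_trans (leq_ord j)) //.
move: lekn; rewrite leq_eqVlt => /predU1P[->|ltkn]; last by rewrite gf // fP.
by rewrite /g eqxx mulrC divfK // pnatr_eq0.
Qed.

(* Multiplying [Mk s k] by the unitriangular matrix whose first column lists
   [f 0, ..., f k.-1] clears its first column except for the bottom entry. *)
Lemma det_Mk (f : nat -> C) (n : nat) :
  f 0%N = 1 -> (forall k, (k < n.+1)%N -> newton_rec f k) ->
  \det (Mk s n.+1) = (-1) ^+ n.+1 * n.+1`!%:R * f n.+1.
Proof.
move=> f0 fP.
pose v : 'cV[C]_n.+1 := \col_j f j.
pose B : 'M[C]_n.+1 := \matrix_(r, c)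
  if c == ord0 then (Mk s n.+1 *m v) r 0 else Mk s n.+1 r c.
have: \det B = \det (Mk s n.+1).
  rewrite (@det_col_replaced _ _ (Mk s n.+1) B v ord0) ?mxE ?f0 ?mulr1 //.
  by move=> r c; rewrite mxE.
move=> <-.
(* By the recursion, the part of row [r] up to the diagonal cancels the superdiagonal term; only the
   last row has no superdiagonal entry. *)
have Mv (r : 'I_n.+1) :
    (Mk s n.+1 *m v) r 0 = if r == ord_max then - n.+1%:R * f n.+1 else 0.
  have lower : \sum_(j < n.+1 | (j <= r)%N) Mk s n.+1 r j * v j 0
             = - (r.+1%:R * f r.+1).
    rewrite fP // opprK (big_ord_widen_cond n.+1 predT (fun j => s (r.+1 - j)%N * f j)) //.
    apply: eq_big => [j|j lejr]; first by rewrite ltnS.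
    by rewrite !mxE lejr addn1 subSn.
  rewrite mxE (bigID (fun j : 'I_n.+1 => (j <= r)%N)) /= lower.
  case: eqP => [->|/eqP rmax].
    rewrite big1 ?addr0 ?mulNr // => j; rewrite -ltnNge ltnNge leq_ord //.
  have ltrn : (r.+1 < n.+1)%N.
    by rewrite ltnS ltn_neqAle -ltnS ltn_ord andbT.
  rewrite (bigD1 (Ordinal ltrn)) /= ?ltnn // big1 ?addr0.
    by rewrite !mxE /= ltnn eqxx addNr.
  move=> j /andP[nlejr jr]; rewrite !mxE (negPf nlejr).
  by rewrite -val_eqE /= in jr; rewrite (negPf jr) mul0r.
have B0 r : B r ord0 = if r == ord_max then - n.+1%:R * f n.+1 else 0.
  by rewrite mxE eqxx Mv.
rewrite (expand_det_col B ord0) (bigD1 ord_max) //= big1 ?addr0; last first.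
  by move=> r rmax; rewrite B0 (negPf rmax) mul0r.
rewrite B0 eqxx /cofactor.
(* The remaining minor is lower triangular: its diagonal is the old superdiagonal 1, ..., n, which
   yields the factorial. *)
have BE (i j : 'I_n) : row' ord_max (col' ord0 B) i j =
    if (j < i)%N then s (i - j)%N else if i == j :> nat then i.+1%:R else 0.
  rewrite !mxE /= /bump leq0n (leqNgt n i) ltn_ord !add0n !add1n eqSS eq_sym.
  by case: ifP => // ltji; rewrite addn1 subnSK.
rewrite det_trig; last first.
  apply/is_trig_mxP => i j ltij.
  by rewrite BE ltnNge (ltnW ltij) /= ltn_eqF.
rewrite (eq_bigr (fun i : 'I_n => i.+1%:R)); last first.
  by move=> i _; rewrite BE ltnn eqxx.
have -> : \prod_(i < n) (i.+1%:R : C) = n`!%:R.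
  by rewrite fact_prod natr_prod big_add1 /= big_mkord.
by rewrite addn0 factS natrM exprS; ring.
Qed.

Lemma Fnat_newton k : newton_rec (Fnat s) k.
Proof.
have [f [f0 fP]] := newton_rec_exists k.+1.
have fE j : (j <= k.+1)%N -> Fnat s j = f j.
  case: j => [|j] ltjk; first by rewrite /Fnat det_mx00 expr0 divr1 mulr1 f0.
  rewrite /Fnat (@det_Mk f) //; last first.
    by move=> i ltij; apply: fP; apply: leq_trans ltij _.
  rewrite -!mulrA [X in _ * X]mulrCA mulKf ?pnatr_eq0 -?lt0n ?fact_gt0 //.
  by rewrite mulrA -exprMn mulrNN mulr1 expr1n mul1r.
rewrite /newton_rec fE // fP //; congr (- _); apply: eq_bigr => j _.
by rewrite fE // ltnW.
Qed.

Lemma Fnat0 : Fnat s 0 = 1.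
Proof. by rewrite /Fnat det_mx00 expr0 divr1 mulr1. Qed.

End Newton.

(** * Logarithmic derivatives modulo ['X^N] *)

Section LogDeriv.
Context {R : fieldType} (N : nat).

(* [u] is, modulo ['X^N], minus the logarithmic derivative ['X * f^`() / f]. *)
Definition log_deriv (f u : {poly R}) : bool := ('X^N %| 'X * f^`() + u * f)%R.

Lemma log_derivM f g u v :
  log_deriv f u -> log_deriv g v -> log_deriv (f * g) (u + v).
Proof.
move=> fu gv; rewrite /log_deriv derivM.
have -> : 'X * (f^`() * g + f * g^`()) + (u + v) * (f * g)
   = g * ('X * f^`() + u * f) + f * ('X * g^`() + v * g) by ring.
by apply: dvdp_add; apply: dvdp_mull.
Qed.

Lemma log_derivB f g u : log_deriv f u -> log_deriv g u -> log_deriv (f - g) u.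
Proof.
move=> fu gu; rewrite /log_deriv derivB.
have -> : 'X * (f^`() - g^`()) + u * (f - g)
   = ('X * f^`() + u * f) - ('X * g^`() + u * g) by ring.
by apply: dvdp_sub.
Qed.

Definition power_poly (s : nat -> R) : {poly R} :=
  \poly_(k < N) if k == 0%N then 0 else s k.

(** Geometric series: a t / (1 - a t) is the sum of a^k t^k over k >= 1. *)
Lemma log_deriv_linear a : log_deriv (1 - a *: 'X) (power_poly (GRing.exp a)).
Proof.
apply/dvdXnP => i ltiN.
rewrite derivB derivZ derivX derivC sub0r mulrBr mulr1 -scalerAr.
rewrite mulrN -scalerAr mulr1 !(coefD, coefN, coefZ, coefX, coefMX) !coef_poly ltiN.
case: i ltiN => [|[|i]] ltiN /=; first by ring.
  by rewrite if_same; ring.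
by rewrite (ltnW ltiN) exprS; ring.
Qed.

(** As [u] has no constant term, coefficient i of the equation expresses i f_i through earlier
    coefficients, and i is invertible for i > 0. The lemma is meant for a difference of two
    solutions. *)
Lemma log_deriv_unique f u : [pchar R] =i pred0 ->
  log_deriv f u -> u`_0 = 0 -> f`_0 = 0 -> ('X^N %| f)%R.
Proof.
move=> /pcharf0P char0 /dvdXnP fu u0 f0; apply/dvdXnP => i.
have [n] := ubnP i; elim: n i => // n IHn [//|i]; rewrite ltnS => ltin ltiN.
have := fu _ ltiN; rewrite coefD coefXM coefMr /= coef_deriv.
rewrite big_ord_recr /= subnn u0 mul0r addr0 big1 ?addr0 => [|j _].
  by move/eqP; rewrite -mulr_natr mulf_eq0 char0 orbF => /eqP.
rewrite IHn ?mulr0 //; first exact: leq_trans (ltn_ord j) ltin.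
exact: ltn_trans (ltn_ord j) ltiN.
Qed.

End LogDeriv.

(** * The generating polynomial of the F_k as a truncated square root *)

Section SquareRoot.
Variables (C : numClosedFieldType) (N : nat).

Lemma log_deriv_Fnat (s : nat -> C) :
  log_deriv N (\poly_(k < N) Fnat s k) (power_poly N s).
Proof.
apply/dvdXnP => -[|i] ltiN; rewrite coefD coefXM coefMr.
  by rewrite big_ord1 !coef_poly ltiN mul0r addr0.
rewrite big_ord_recr /= subnn [X in X * _]coef_poly if_same mul0r addr0.
rewrite coef_deriv coef_poly ltiN -mulr_natl Fnat_newton.
rewrite [X in _ + X](eq_bigr (fun j : 'I_i.+1 => s (i.+1 - j)%N * Fnat s j)).
  by rewrite addNr.
move=> j _; rewrite !coef_poly (ltn_trans (ltn_ord j) ltiN).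
rewrite (leq_ltn_trans (leq_subr _ _) ltiN) subn_eq0 leqNgt ltn_ord //.
Qed.

Lemma sqr_Fnat_modXn (a b c d : C) : (0 < N)%N ->
  ('X^N %| (\poly_(k < N) Fnat (spow a b c d) k) ^+ 2
     - (1 - a *: 'X) * (1 - b *: 'X) * (1 - c *: 'X) * (1 - d *: 'X))%R.
Proof.
move=> N_gt0; set s := spow a b c d.
apply: (@log_deriv_unique _ _ _ (power_poly N s + power_poly N s)).
- exact: Num.Theory.pchar_num.
- apply: log_derivB; first by rewrite expr2; apply: log_derivM; apply: log_deriv_Fnat.
  (* Squaring doubles [s], which cancels the 1/2 in [spow] and leaves one geometric series per
     linear factor. *)
  have -> : power_poly N s + power_poly N s =
    power_poly N (GRing.exp a) + power_poly N (GRing.exp b)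
    + power_poly N (GRing.exp c) + power_poly N (GRing.exp d).
    apply/polyP => k; rewrite !(coefD, coef_poly); case: ifP; rewrite ?addr0 //.
    by case: eqP; rewrite ?addr0 // /s /spow => _ _; field.
  by do 3![apply: log_derivM; last exact: log_deriv_linear]; exact: log_deriv_linear.
- by rewrite !(coefD, coef_poly) if_same addr0.
- rewrite -horner_coef0 !hornerE horner_coef0 coef_poly N_gt0 Fnat0.
  by ring.
Qed.

End SquareRoot.

(* In the variable t = 1/z, [p] and [q1] are the reversals of the products over
   the y_j and the x_j, and [q / p] is a Pade approximant of [G]. *)
Section Pade.
Variables (K : fieldType) (m : nat) (A p q1 G : {poly K}) (d e : K).
Let q := (1 - d *: 'X) * q1.
Hypotheses (two_neq0 : 2%:R != 0 :> K) (e_neq0 : e != 0).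
Hypotheses (p0 : p`_0 = 1) (q0 : q1`_0 = 1) (G0 : G`_0 = 1).
Hypothesis pell : A * p ^+ 2 - (1 - d *: 'X) * q1 ^+ 2 = e *: 'X^(m.*2.+1).
Hypothesis sqrG : ('X^(m.*2.+1) %| G ^+ 2 - A * (1 - d *: 'X))%R.

Lemma pade_exists : ('X^(m.*2.+1) %| G * p - q)%R.
Proof.
have cop : coprimep ('X^(m.*2.+1)) (G * p + q).
  apply: coprimepXn; rewrite -horner_coef0 !hornerE !horner_coef0 p0 q0 G0.
  by rewrite (_ : _ + _ = 2%:R) //; ring.
rewrite -(Gauss_dvdpl _ cop).
have -> : (G * p - q) * (G * p + q) = (G ^+ 2 - A * (1 - d *: 'X)) * p ^+ 2
   + (1 - d *: 'X) * (A * p ^+ 2 - (1 - d *: 'X) * q1 ^+ 2) by rewrite /q; ring.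
rewrite pell; apply: dvdp_add; first exact: dvdp_mulr.
by apply: dvdp_mull; rewrite -mul_polyC dvdp_mull.
Qed.

Hypotheses (szA : (size A <= 4)%N) (szp : (size p <= m)%N).
Hypothesis (szq1 : (size q1 <= m.+1)%N).

Lemma size_pade_num : (size q <= m.+2)%N.
Proof.
exact: size_polyM_le (size_1subZX d) szq1.
Qed.

(** Cross-multiplying with the approximant q / p gives p r - q w, divisible by ['X^(m.*2.+1)] yet of
    smaller degree, hence 0. The Pell relation then makes w proportional to p, and the constant
    terms 0 and 1 force w = 0. *)
Lemma pade_unique (w r : {poly K}) :
  (size w <= m)%N -> (size r <= m.+2)%N -> w`_0 = 0 ->
  ('X^(m.*2.+1) %| G * w - r)%R -> w = 0.
Proof.
move=> szw szr w0 Gwr.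
have cross : p * r = q * w.
  have /dvdXnP pr : ('X^(m.*2.+1) %| p * r - q * w)%R.
    have -> : p * r - q * w = w * (G * p - q) - p * (G * w - r) by ring.
    by rewrite dvdp_sub // dvdp_mull // pade_exists.
  apply/eqP; rewrite -subr_eq0; apply/eqP/polyP=> i; rewrite coef0.
  have [/pr //|leNi] := ltnP i m.*2.+1.
  apply: nth_default; apply: leq_trans leNi.
  apply: size_polyB_le.
    by apply: leq_trans (size_polyM_le szp szr) _; lia.
  by apply: leq_trans (size_polyM_le size_pade_num szw) _; lia.
pose f := A * p * w - q1 * r.
have fE : p * f = e *: 'X^(m.*2.+1) * w.
  rewrite -pell; transitivity (A * p ^+ 2 * w - q1 * (p * r)); first by rewrite /f; ring.
  by rewrite cross /q; ring.
(* [p] is a unit modulo ['X^(m.*2.+1)], so the power divides [f]; the degree of [f] is at most that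
   exponent, so [f] is a monomial. *)
have /dvdXnP f_low : ('X^(m.*2.+1) %| f)%R.
  have cop : coprimep ('X^(m.*2.+1)) p by apply: coprimepXn; rewrite p0 oner_eq0.
  rewrite -(Gauss_dvdpr _ cop) fE -scalerAl -mul_polyC.
  by rewrite dvdp_mull // dvdp_mulr.
have {}f_low : f = f`_(m.*2.+1) *: 'X^(m.*2.+1).
  apply/polyP=> i; rewrite coefZ coefXn.
  case: (ltngtP i m.*2.+1) => [/f_low ->|lti|->]; rewrite ?mulr0 ?mulr1 //.
  apply: nth_default; apply: leq_trans lti.
  apply: size_polyB_le.
    have szApw := size_polyM_le (size_polyM_le szA szp) szw.
    by apply: leq_trans szApw _; lia.
  by apply: leq_trans (size_polyM_le szq1 szr) _; lia.
set k := f`_ _ in f_low.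
have ew : e *: w = k *: p.
  apply: (@mulfI _ 'X^(m.*2.+1)); first by rewrite -size_poly_gt0 size_polyXn.
  by rewrite -scalerAr scalerAl -fE {1}f_low -!scalerAr mulrC.
have k0 : k = 0.
  by have := congr1 (fun g : {poly K} => g`_0) ew; rewrite !coefZ w0 p0 mulr0 mulr1.
by move/eqP: ew; rewrite k0 scale0r scaler_eq0 (negPf e_neq0) => /eqP.
Qed.

End Pade.

(** * Passing from z to t = 1/z *)

Section Reversal.
Variables (C : numClosedFieldType).

Lemma horner_prod_rev (n : nat) (x : 'I_n -> C) (t : C) : t != 0 ->
  (\prod_j (1 - x j *: 'X)).[t] = t ^+ n * (\prod_j ('X - (x j)%:P)).[t^-1].
Proof.
move=> t0; rewrite !horner_prod -[n in t ^+ n]card_ord -prodr_const -big_split /=.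
by apply: eq_bigr => j _; rewrite !hornerE /= mulrBr divff // mulrC.
Qed.

Lemma size_prod_rev (n : nat) (x : 'I_n -> C) :
  (size (\prod_j (1 - x j *: 'X))%R <= n.+1)%N.
Proof.
elim: n x => [|n IHn] x; first by rewrite big_ord0 size_poly1.
rewrite big_ord_recr /=.
by apply: leq_trans (size_polyM_le (IHn _) (size_1subZX _)) _; rewrite addn2.
Qed.

Lemma coef0_prod_rev (n : nat) (x : 'I_n -> C) :
  (\prod_j (1 - x j *: 'X))`_0 = 1.
Proof.
rewrite -horner_coef0 horner_prod big1 // => j _.
by rewrite !hornerE subr0.
Qed.

Lemma lead_monic_coef (p : {poly C}) (n : nat) :
  p \is monic -> size p = n.+1 -> p`_n = 1.
Proof. by move=> /monicP <- szp; rewrite lead_coefE szp. Qed.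

(** Here [m] is one less than in the theorem. The exact degree of T forces [be] to be nonzero and
    [al = - be]; subtracting the two forms leaves the constant 2 / be, and e is this constant. *)
Lemma pell_of_two_forms (m : nat) (a b c d al be : C) (T : {poly C})
    (x : 'I_m.+1 -> C) (y : 'I_m -> C) :
  size T = (2 * m.+1 + 1).+1 ->
  T = 1 - al *: (('X - d%:P) * \prod_j ('X - (x j)%:P) ^+ 2) ->
  T = -1 + be *: (('X - a%:P) * ('X - b%:P) * ('X - c%:P)
                    * \prod_j ('X - (y j)%:P) ^+ 2) ->
  exists2 e, e != 0 &
    (1 - a *: 'X) * (1 - b *: 'X) * (1 - c *: 'X)
      * (\prod_j (1 - y j *: 'X)) ^+ 2
    - (1 - d *: 'X) * (\prod_j (1 - x j *: 'X)) ^+ 2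
    = e *: 'X^(m.+1.*2.+1).
Proof.
rewrite !prodrXl mulSn addnC !addnS !addnA /= => szT.
set P := \prod_j ('X - (x j)%:P); set Q := \prod_j ('X - (y j)%:P).
set L := _ * P ^+ 2; set M := _ * Q ^+ 2 => TL TM.
have Pm : P \is monic by apply: monic_prod_XsubC.
have Qm : Q \is monic by apply: monic_prod_XsubC.
have szP : size P = m.+2 by rewrite size_prod_XsubC [index_enum _]unlock -enumT size_enum_ord.
have szQ : size Q = m.+1 by rewrite size_prod_XsubC [index_enum _]unlock -enumT size_enum_ord.
have mX (u : C) : 'X - u%:P \is monic by apply: monicXsubC.
have Ln : L`_(m.+1.*2.+1) = 1.
  apply: lead_monic_coef; first by rewrite /L expr2 !rpredM.
  rewrite /L expr2 !(size_Mmonic, monic_neq0, rpredM) // size_XsubC szP.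
  by rewrite -addnn; lia.
have Mn : M`_(m.+1.*2.+1) = 1.
  apply: lead_monic_coef; first by rewrite /M expr2 !rpredM.
  rewrite /M expr2 !(size_Mmonic, monic_neq0, rpredM) // !size_XsubC szQ.
  by rewrite -addnn; lia.
have TnL : T`_(m.+1.*2.+1) = - al.
  by rewrite TL coefB coefZ Ln coef1 sub0r mulr1.
have TnM : T`_(m.+1.*2.+1) = be.
  by rewrite TM coefD coefN coefZ Mn coef1 oppr0 add0r mulr1.
have be0 : be != 0.
  rewrite -TnM; have : lead_coef T != 0 by rewrite lead_coef_eq0 -size_poly_gt0 szT.
  by rewrite lead_coefE szT /=; congr (_`_ _ != 0); lia.
have alE : al = - be by rewrite -TnM TnL opprK.
have MLE : M - L = (2%:R / be)%:P.
  apply: (scalerI be0); rewrite scalerBr -[RHS]mul_polyC -polyCM mulrCA divff // mulr1.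
  have -> : be *: M = T + 1 by rewrite TM; ring.
  have -> : be *: L = T - 1 by rewrite TL alE scaleNr; ring.
  by rewrite polyCMn; ring.
exists (2%:R / be); first by rewrite mulf_neq0 ?invr_eq0 // pnatr_eq0.
apply: eq_poly_nonzero => t t0.
have := congr1 (fun p => p.[t^-1]) MLE; rewrite /L /M.
rewrite [X in _ -> _ = X]hornerZ hornerXn.
rewrite !(hornerD, hornerN, hornerM, hornerZ, hornerX, hornerC, horner_exp).
rewrite !horner_prod_rev // -/P -/Q => MLt.
rewrite -MLt.
have -> : t ^+ (m.+1).*2.+1 = t ^+ 3 * (t ^+ m) ^+ 2.
  by rewrite -exprM -exprD; congr (_ ^+ _); lia.
rewrite exprS; move: (t ^+ m) => tm.
by field.
Qed.

End Reversal.

(** * The linear system for the y_j *)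

(** The matrix product is a convolution. The first bound keeps every index nu + i - j nonnegative,
    the second keeps it below the truncation order; the factor ['X] leaves room for a constant term
    1. *)
Lemma FF_mulE (C : numClosedFieldType) (s : nat -> C) (N nu mu : nat)
    (v : 'cV[C]_mu) (i : 'I_mu) : (mu <= nu.+1)%N -> (nu + mu < N)%N ->
  (FF s nu mu *m v) i 0 =
  ('X * (\sum_j v j 0 *: 'X^j) * \poly_(k < N) Fnat s k)`_(nu + i).+1.
Proof.
move=> lemu ltN; rewrite -mulrA coefXM /= mulr_suml coef_sum mxE.
apply: eq_bigr => j _; rewrite -scalerAl coefZ coefXnM coef_poly mxE.
have lej : (j <= nu + i)%N.
  by have := ltn_ord j; move: (nat_of_ord j) (nat_of_ord i) => k l; lia.
have -> : (nu + i - j < N)%N.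
  by have := ltn_ord i; move: (nat_of_ord j) (nat_of_ord i) => k l; lia.
by rewrite ltnNge lej /= -PoszD subzn // mulrC.
Qed.

Theorem theorem1 (C : numClosedFieldType) (m : nat) (hm : (1 <= m)%N)
  (a b c d : C) (T U : {poly C})
  (x : 'I_m -> C) (y : 'I_m.-1 -> C) :
  size T = (2 * m + 1).+1 ->
  (size U <= (2 * m + 1).-1)%N ->
  T ^+ 2 - Hpoly a b c d * U ^+ 2 = 1 ->
  T = 1 - (2%:R / ((a - d) * \prod_(j < m) (a - x j) ^+ 2)) *:
          (('X - d%:P) * \prod_(j < m) ('X - (x j)%:P) ^+ 2) ->
  T = -1 + (2%:R / ((d - a) * (d - b) * (d - c) * \prod_(j < m.-1) (d - y j) ^+ 2)) *:
          (('X - a%:P) * ('X - b%:P) * ('X - c%:P) * \prod_(j < m.-1) ('X - (y j)%:P) ^+ 2) ->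
  \det (FF (spow a b c d) m.+1 m.-1) != 0 /\
  Fpoly (spow a b c d) m.+1 m.-1
    = \det (FF (spow a b c d) m.+1 m.-1) *: \prod_(j < m.-1) ('X - (y j)%:P).
Proof.
case: m hm x y => // m _ x y szT _ _ /(pell_of_two_forms szT) TL {}/TL /=.
set s := spow a b c d; set A := (1 - _) * _ * _.
set p := \prod_j (1 - y j *: 'X); set q1 := \prod_j (1 - x j *: 'X).
move=> [e e0 pell]; set N := (m.+1.*2.+1)%N in pell.
pose G := \poly_(k < N) Fnat s k.
pose W (v : 'cV[C]_m) : {poly C} := 'X * \sum_j v j 0 *: 'X^j.
have two0 : 2%:R != 0 :> C by rewrite pnatr_eq0.
have G0 : G`_0 = 1 by rewrite coef_poly Fnat0.
have p0 : p`_0 = 1 := coef0_prod_rev y.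
have q0 : q1`_0 = 1 := coef0_prod_rev x.
have sqrG : ('X^N %| G ^+ 2 - A * (1 - d *: 'X))%R by apply: sqr_Fnat_modXn.
have szp : (size p <= m.+1)%N := size_prod_rev y.
have szq1 : (size q1 <= m.+2)%N := size_prod_rev x.
have szlin := @size_1subZX C.
have szA : (size A <= 4)%N.
  exact: (size_polyM_le (size_polyM_le (szlin a) (szlin b)) (szlin c)).
have FFE (v : 'cV[C]_m) (i : 'I_m) :
    (FF s m.+2 m *m v) i 0 = (W v * G)`_(m.+2 + i).+1.
  by apply: FF_mulE; rewrite /N; lia.
have WE (v : 'cV[C]_m) : W v = 'X * \poly_(j < m) (if insub j is Some i then v i 0 else 0).
  by rewrite /W poly_def; congr (_ * _); apply: eq_bigr => j _; rewrite valK.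
pose v : 'cV[C]_m := \col_j p`_j.+1.
have pE : p = 1 + W v.
  apply/polyP=> -[|k]; rewrite WE coefD coef1 coefXM /= ?addr0 // coef_poly add0r.
  case: ifP => [ltkm|/negbT]; first by rewrite insubT mxE.
  by rewrite -leqNgt => lemk; rewrite nth_default // (leq_trans szp).
have FFv (i : 'I_m) : (FF s m.+2 m *m v) i 0 = - Fnat s (m.+2 + i).+1.
  have ltiN : ((m.+2 + i).+1 < N)%N.
    by have := ltn_ord i; move: (nat_of_ord i) => k; rewrite /N -addnn; lia.
  have /dvdXnP/(_ _ ltiN) := pade_exists two0 p0 q0 G0 pell sqrG.
  (* The numerator has degree at most m + 2, so these coefficients of G p vanish; the term 1 of [p]
     supplies the right-hand side. *)
  rewrite coefB [X in _ - X]nth_default ?subr0; last first.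
    apply: leq_trans (size_pade_num d szq1) _; rewrite -addSn; exact: leq_addr.
  rewrite pE mulrDr mulr1 coefD coef_poly ltiN mulrC FFE.
  by move/eqP; rewrite addrC addr_eq0 => /eqP.
have detFFi (i : 'I_m) : \det (FFi s m.+2 i) = \det (FF s m.+2 m) * p`_i.+1.
  rewrite (@det_col_replaced _ _ (FF s m.+2 m) _ v i) ?mxE // => r k.
  by rewrite FFv mxE addn1.
split.
  (* A kernel vector kills the coefficients m + 3, ..., 2m + 2 of [G * W u^T]; truncating this
     product below them gives a numerator to which [pade_unique] applies. *)
  rewrite -det_tr; apply/det0P => -[u u0].
  move/(congr1 trmx); rewrite trmx_mul trmxK trmx0 => FFu.
  have szW : (size (W u^T) <= m.+1)%N.
    rewrite WE; have szX : (size ('X : {poly C}) <= 2)%N by rewrite size_polyX.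
    exact: size_polyM_le szX (size_poly _ _).
  have W0 : W u^T = 0.
    apply: (pade_unique two0 e0 p0 q0 G0 pell sqrG szA szp szq1
              szW (size_take_poly m.+3 (G * W u^T))).
      by rewrite coefXM.
    apply/dvdXnP => k ltkN; rewrite coefB coef_take_poly.
    case: ltnP => [|lemk]; first by rewrite subrr.
    have ltim : (k - m.+3 < m)%N by move: ltkN; rewrite /N -addnn; lia.
    have := FFE u^T (Ordinal ltim); rewrite FFu mxE /= -addSn subnKC // mulrC.
    by move=> <-; rewrite subr0.
  case/eqP: u0; apply/rowP => i; rewrite mxE.
  have := congr1 (fun g : {poly C} => g`_i.+1) W0.
  by rewrite WE coefXM /= coef_poly ltn_ord valK mxE coef0.
rewrite /Fpoly (eq_bigr (fun i : 'I_m =>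
  \det (FF s m.+2 m) *: (p`_i.+1 *: 'X^(m - 1 - i)))); last first.
  by move=> i _; rewrite scalerA -detFFi.
rewrite -scaler_sumr -scalerDr; congr (_ *: _).
(* Undo the reversal: p(1/z) is z^(-m) times the product of the z - y_j. *)
apply: eq_poly_nonzero => z z0.
have := horner_prod_rev y (invr_neq0 z0); rewrite invrK -/p => pz.
have zm0 : z ^+ m != 0 by rewrite expf_neq0.
apply: (mulfI (invr_neq0 zm0)); rewrite -exprVn -pz [in RHS]pE.
rewrite /W !hornerE horner_sum !horner_sum mulrDr exprVn mulVf //.
congr (1 + _); rewrite !mulr_sumr; apply: eq_bigr => i _.
rewrite !hornerE /= mxE mulrAC [RHS]mulrAC; congr (_ * _).
have zi0 : z ^+ i.+1 != 0 by rewrite expf_neq0.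
apply: (mulIf zi0); rewrite -exprS exprVn mulVf // -mulrA -exprD.
have -> : (m - 1 - i + i.+1 = m)%N by have := ltn_ord i; lia.
by rewrite mulVf.
Qed.
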